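(* Suppose a tree $T$ is such that the distance between any two leaves of $T$ is even. Then $T$ is a good tree if and only if there exists a leaf of $T$ that is adjacent to a vertex of degree $2$.
   Context: All graphs are simple, finite and undirected; $e(G)$ denotes the number of edges of $G$. A leaf is a vertex of degree $1$. Given a graph $F$, a graph $G$ is weakly $F$-saturated if the non-edges of $G$ can be added one by one in some order, ending with the complete graph on $V(G)$, so that each newly added edge creates a new copy of $F$ (a subgraph isomorphic to $F$, not necessarily induced, containing the new edge). For an integer $n$, $\text{w-sat}(n,F)$ is the minimum number of edges of an $n$-vertex weakly $F$-saturated graph. For a tree $T$ with at least one edge, $\text{w-sat}(n,T)$ is constant for all sufficiently large $n$, and $\text{w-sat}(T)$ denotes this limit value. A tree $T$ is called good if $\text{w-sat}(T)=e(T)-1$. *)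

(* Defs.v *)
From HB Require Import structures.
From mathcomp Require Import all_boot.

Set Implicit Arguments.
Unset Strict Implicit.
Unset Printing Implicit Defensive.

(* A simple graph on the vertex set V is a set of two-element subsets of V. *)
Record sgraph (V : finType) := SGraph {
  edges : {set {set V}};
  edgesP : [forall e in edges, #|e| == 2] }.

HB.instance Definition _ (V : finType) := [isSub for @edges V].
HB.instance Definition _ (V : finType) := [Countable of sgraph V by <:].
HB.instance Definition _ (V : finType) := [Finite of sgraph V by <:].

Section Graph.
Variable V : finType.

Definition all_edges : {set {set V}} := [set e : {set V} | #|e| == 2].

Lemma all_edgesP : [forall e in all_edges, #|e| == 2].
Proof. by apply/forall_inP => e; rewrite inE. Qed.

Definition complete : sgraph V := SGraph all_edgesP.

Variable G : sgraph V.

Definition adj : rel V := fun x y => [set x; y] \in edges G.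

Definition deg (x : V) : nat := #|[set y | adj x y]|.

Definition leaf (x : V) : bool := deg x == 1.

Definition connected : Prop := forall x y : V, connect adj x y.

Definition acyclic : Prop := forall c : seq V, 2 < size c -> ~ ucycle adj c.

Definition tree : Prop := [/\ 0 < #|V|, connected & acyclic].

(* The least number of edges of a walk from x to y; in a connected graph this  *)
(* is less than #|V|, and dist x y = #|V| when y is not reachable from x.      *)
Definition dist (x y : V) : nat :=
  find (fun k => [exists p : k.-tuple V, path adj x p && (last x p == y)])
       (iota 0 #|V|).

End Graph.

Section WeakSaturation.
Variables (U : finType) (F : sgraph U).

(* Some copy of F in the graph with edge set E uses the edge e. *)
Definition copy_through (V : finType) (E : {set {set V}}) (e : {set V}) : bool :=
  [exists f : {ffun U -> V},
    [&& injectiveb f,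
        [forall a in edges F, f @: a \in E] &
        [exists a in edges F, f @: a == e]]].

Fixpoint saturating (V : finType) (E : {set {set V}}) (s : seq {set V}) : bool :=
  if s is e :: s' then copy_through (e |: E) e && saturating (e |: E) s'
  else true.

Definition weakly_saturated (V : finType) (G : sgraph V) : bool :=
  has (saturating (edges G)) (permutations (enum (all_edges V :\: edges G))).

Lemma complete_weakly_saturated (V : finType) :
  weakly_saturated (complete V).
Proof.
by apply/hasP; exists [::]; rewrite // mem_permutations /= setDv enum_set0.
Qed.

(* The complete graph only witnesses that the minimum is over a nonempty set. *)
Definition wsat (n : nat) : nat :=
  #|edges [arg min_(G < complete 'I_n | weakly_saturated G) #|edges G|]|.

Definition wsat_limit (v : nat) : Prop :=
  exists N : nat, forall n : nat, N <= n -> wsat n = v.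

(* The subtraction is truncated only when F has no edge. In that case no edge  *)
(* creates a copy of F, wsat n = 'C(n, 2), and F is not good.                  *)
Definition good : Prop := wsat_limit (#|edges F| - 1).

End WeakSaturation.

(* Main.v *)
Require Import Defs.
From mathcomp Require Import all_boot.
From mathcomp Require Import zify.

(** Adding an edge can create a copy of the tree [T] only if the graph already
    has [e(T) - 1] edges, so a good tree is one for which this obvious lower
    bound is attained for all large [n].

    A leaf [l] next to a vertex [w] of degree 2 makes [T] good, whatever the
    other distances are: the pendant path [z - w - l] can be rerouted through
    isolated vertices. Starting from [T] without an edge, this joins [w], then
    [z], to all vertices outside, then the vertices outside to each other. The
    resulting large clique absorbs all remaining vertices
    ([pendant_weakly_saturated]).

    Conversely, suppose that no leaf is next to a vertex of degree 2. Since all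
    leaves are at even distance, they lie in the same class of the bipartition
    of [T]; let [B] be the other class. A weakly saturated graph with
    [e(T) - 1] edges turns into a copy of [T] plus isolated vertices as soon as
    the first edge is added, so it is contained in the complete bipartite graph
    between the image of [B] and everything else. This bipartite graph is
    closed under the process ([cut_closed]), hence the complete graph is never
    reached. Closedness comes down to a count in [T]: a colouring of its
    vertices for which exactly one edge is monochromatic has more than [#|B|]
    vertices in each colour ([one_monochromatic_edge]). The proof compares the
    degrees, at least 2 in [B] and at least 3 next to a leaf, with the number
    of edges of a forest. *)

Set Implicit Arguments.
Unset Strict Implicit.
Unset Printing Implicit Defensive.

(** * Forests *)

Section Forest.
Variables (V : finType) (G : sgraph V).
Implicit Types (S : {set V}) (x y : V).

Lemma adj_sym : symmetric (adj G).
Proof. by move=> x y; rewrite /adj setUC. Qed.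

Lemma adj_irr x : adj G x x = false.
Proof.
apply/negP => /(forall_inP (edgesP G)).
by rewrite setUid cards1.
Qed.

Lemma edge_ends (a : {set V}) : a \in edges G -> exists x y, a = [set x; y].
Proof.
by move=> /(forall_inP (edgesP G)) /cards2P[x [y [_ ->]]]; exists x, y.
Qed.

(** Summing the adjacency indicator, rather than taking a cardinal, lets the
    edges between two sets be counted from both sides by exchanging sums. *)
Definition deg_in S x : nat := \sum_(y in S) adj G x y.

Lemma deg_in_setT x : deg_in setT x = deg G x.
Proof.
rewrite /deg_in /deg -sum1_card [RHS]big_mkcond /=.
apply: eq_big => [y|y _]; first by rewrite inE.
by rewrite inE; case: adj.
Qed.

Lemma deg_in_gt1 S x y :
  1 < deg_in S x -> exists z, [/\ z \in S, adj G x z & z != y].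
Proof.
have [/existsP[z /and3P[]]|/existsPn no] :=
  boolP [exists z, [&& z \in S, adj G x z & z != y]]; first by exists z.
have out z : z \in S -> z != y -> adj G x z = false.
  by move=> zS zy; have := no z; rewrite zS zy andbT; case: adj.
suff small : deg_in S x <= 1 by rewrite ltnNge small.
rewrite /deg_in; have [yS|yS] := boolP (y \in S).
  rewrite (bigD1 y) //= big1 ?addn0 ?leq_b1 // => z /andP[zS zy].
  by rewrite out.
rewrite big1 // => z zS; rewrite out //.
by apply: contraNneq yS => <-.
Qed.

Hypothesis acG : acyclic G.

(** If every vertex of [S] had two neighbours in [S], a path starting in [S]
    could always be prolonged at its start: one of the two neighbours is not
    the next vertex of the path, and it cannot lie further along the path
    without closing a cycle. Paths without repetition would get arbitrarily
    long. *)
Lemma acyclic_low_degree S :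
  S != set0 -> exists2 x, x \in S & deg_in S x <= 1.
Proof.
move=> /set0Pn[x0 x0S].
have [/exists_inP//|] := boolP [exists x in S, deg_in S x <= 1].
rewrite negb_exists_in => /forall_inP big; exfalso.
have long k : exists x p, [/\ size p = k, path (adj G) x p, uniq (x :: p) & x \in S].
  elim: k => [|k [x [p [<- px Ux xS]]]]; first by exists x0, [::].
  have /(deg_in_gt1 (head x p))[y [yS xy yp]] : 1 < deg_in S x.
    by rewrite ltnNge big.
  have yx : y != x by apply: contraTneq xy => ->; rewrite adj_irr.
  have [yinp|yNp] := boolP (y \in p); last first.
    exists y, (x :: p); split=> //=; first by rewrite adj_sym xy.
    by rewrite inE negb_or yx yNp.
  case/splitPr: yinp px Ux yp => p1 p2 px Ux yp; exfalso.
  apply: (acG (c := x :: rcons p1 y)).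
    by case: p1 yp {px Ux} => [|? ?] /=; rewrite ?eqxx // size_rcons.
  rewrite -cat_rcons in px Ux.
  rewrite /ucycle /cycle rcons_path last_rcons adj_sym xy andbT.
  move: px; rewrite cat_path => /andP[-> _] /=.
  by move: Ux; rewrite -cat_cons cat_uniq => /andP[].
have [x [p [sp _ /card_uniqP Ux _]]] := long #|V|.
by have := max_card (mem (x :: p)); rewrite Ux /= sp ltnn.
Qed.

(** A forest is built by adding vertices that see at most one earlier vertex;
    the two lemmas that follow are inductions of this kind. *)
Lemma acyclic_ind (P : {set V} -> Prop) :
    P set0 ->
    (forall S x, x \notin S -> deg_in S x <= 1 -> P S -> P (x |: S)) ->
  forall S, P S.
Proof.
move=> P0 Pstep S; have [k] := ubnP #|S|; elim: k S => // k IHk S Sk.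
have [->//|/acyclic_low_degree[x xS dx]] := eqVneq S set0.
have xNS : x \notin S :\ x by rewrite !inE eqxx.
rewrite -(setD1K xS); apply: Pstep => //.
  move: dx; rewrite /deg_in (big_setD1 x xS) /=; lia.
by apply: IHk; move: Sk; rewrite (cardsD1 x S) xS.
Qed.

(** The sum counts every edge inside [S] twice, so this says that a nonempty
    forest has fewer edges than vertices. *)
Lemma forest_bound S :
  S != set0 -> \sum_(x in S) deg_in S x + 2 <= 2 * #|S|.
Proof.
elim/acyclic_ind: S => [|S x xS dx IHS _]; first by rewrite eqxx.
have -> : \sum_(y in x |: S) deg_in (x |: S) y
          = \sum_(y in S) deg_in S y + 2 * deg_in S x.
  rewrite big_setU1 //= {1}/deg_in big_setU1 //= adj_irr add0n -/(deg_in S x).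
  rewrite (eq_bigr (fun y => adj G x y + deg_in S y)); last first.
    by move=> y yS; rewrite {1}/deg_in big_setU1 //= adj_sym.
  rewrite big_split /= -/(deg_in S x); lia.
rewrite cardsU1 xS /=; have [S0|/IHS] := eqVneq S set0; last lia.
by rewrite S0 /deg_in !big_set0 cards0.
Qed.

Lemma two_coloring : exists c : V -> bool, forall x y, adj G x y -> c x != c y.
Proof.
suff [c cP] : exists c : V -> bool, forall x y,
    x \in [set: V] -> y \in [set: V] -> adj G x y -> c x != c y.
  by exists c => x y; apply: cP; rewrite inE.
elim/acyclic_ind: [set: V] => [|S x xS dx [c cP]].
  by exists xpredT => x y; rewrite inE.
have [b bP] : exists b, forall y, y \in S -> adj G x y -> c y != b.
  have [/exists_inP[y yS xy]|] := boolP [exists y in S, adj G x y]; last first.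
    rewrite negb_exists_in => /forall_inP no; exists true => y yS xy.
    by have := no y yS; rewrite xy.
  exists (~~ c y) => z zS xz; have [->|zy] := eqVneq z y; first by case: (c y).
  move: dx; rewrite /deg_in (bigD1 y) //= (bigD1 z) /= ?zS ?zy // xy xz; lia.
exists (fun y => if y == x then b else c y) => y z.
rewrite !inE; case: eqP => [->|_] /=; case: eqP => [->|_] //=.
- by rewrite adj_irr.
- by move=> _ zS xz; rewrite eq_sym bP.
- by move=> yS _; rewrite adj_sym; apply: bP.
- exact: cP.
Qed.

End Forest.

Section Tree.
Variables (V : finType) (T : sgraph V).

Lemma dist_walk (x y : V) : connected T ->
  exists p, [/\ path (adj T) x p, last x p = y & size p = dist T x y].
Proof.
move=> conT; rewrite /dist; set a := (fun k : nat => _).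
have : has a (iota 0 #|V|).
  have /connectP[p px] := conT x y.
  case/shortenP: px => q qx Uq _ yq; apply/hasP; exists (size q).
    by rewrite mem_iota /=; move/card_uniqP: Uq => /= <-; apply: max_card.
  by apply/existsP; exists (in_tuple q); rewrite /= qx yq eqxx.
move=> ha; have := nth_find 0 ha; rewrite nth_iota; last first.
  by move: ha; rewrite has_find size_iota.
by case/existsP=> p /andP[px /eqP py]; exists p; rewrite size_tuple.
Qed.

(** The colour changes at every step of a walk, so the parity of a distance
    compares the colours of its ends. *)
Lemma odd_dist (c : V -> bool) : connected T ->
    (forall x y, adj T x y -> c x != c y) ->
  forall x y, odd (dist T x y) = (c x != c y).
Proof.
move=> conT cP x y; have [p [px <- <-]] := dist_walk x y conT.
elim: p x px => [|z p IHp] x /=; first by rewrite eqxx.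
case/andP=> /cP xz /IHp ->.
by move: xz; case: (c x); case: (c z); case: (c _).
Qed.

Lemma deg_gt0 (x : V) : connected T -> 1 < #|V| -> 0 < deg T x.
Proof.
move=> conT V2; have [y yx] : exists y, y != x.
  apply/existsP; apply: contraTT V2 => /existsPn no; rewrite -leqNgt -(card1 x).
  by apply: subset_leq_card; apply/subsetP => y _; have := no y; rewrite negbK.
have /connectP[[|z p] /=] := conT x y; first by move=> _ exy; rewrite exy eqxx in yx.
by case/andP=> xz _ _; apply/card_gt0P; exists z; rewrite inE.
Qed.

Lemma tree_has_leaf : tree T -> 1 < #|V| -> exists x, leaf T x.
Proof.
case=> V0 conT acT V2.
have [|x _ dx] := acyclic_low_degree acT (S := setT).
  by rewrite -card_gt0 cardsT.
exists x; rewrite /leaf eqn_leq -{1}deg_in_setT dx.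
exact: deg_gt0.
Qed.

End Tree.

(** * Colourings of a tree with one monochromatic edge *)

Lemma card_pairI (W : finType) (P : {set W}) x y : x != y ->
  #|[set x; y] :&: P| = (x \in P) + (y \in P).
Proof.
move=> xy; rewrite -sum1_card big_mkcond (bigD1 x) //= (bigD1 y) 1?eq_sym //=.
rewrite big1 => [|z /andP[/negbTE zx /negbTE zy]]; last by rewrite !inE zx zy.
by rewrite addn0 !inE !eqxx orbT /=; case: (x \in P); case: (y \in P).
Qed.

Section Recoloring.
Variables (V : finType) (T : sgraph V) (B : {set V}).
Hypothesis acT : acyclic T.
Hypothesis B_proper : forall x y, adj T x y -> (x \in B) != (y \in B).
Hypothesis B_deg : forall x, x \in B -> 1 < deg T x.
Hypothesis leaf_nb : forall x y, leaf T x -> adj T x y -> 2 < deg T y.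
Hypothesis deg_pos : forall x, 0 < deg T x.

(** Let [S] be the set of vertices on which the colourings [X] and [B]
    disagree; the only edge leaving [S] is [uv]. If [X] were no larger than
    [B], then [S] would have at most as many vertices outside [B] as inside.
    Count the [D] edges inside [S] by their ends in [B]: these vertices have
    degree at least 2, and at most one edge at them leaves [S]. The forest
    bound on [D] forces [u] to be in [S], [v] to be outside and all vertices of
    [S :&: B] to have degree 2. Hence no leaf is in [S], since its neighbour
    would be in [S :&: B] and of degree at least 3. Now the vertices of
    [S :\: B] have degree at least 2 inside [S] as well, and counting from both
    sides gives more edges than a forest can have. *)
Lemma one_monochromatic_edge (X : {set V}) (u v : V) :
    adj T u v -> (u \in X) = (v \in X) ->
    (forall x y, adj T x y -> (x \in X) = (y \in X) -> [set x; y] = [set u; v]) ->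
  #|B| < #|X|.
Proof.
wlog uB : u v / u \in B.
  move=> wl uv Xuv mono; have := B_proper uv.
  have [uB _|uNB] := boolP (u \in B); first exact: wl uB uv Xuv mono.
  have [vB _|//] := boolP (v \in B).
  by apply: (wl v u) => //; rewrite 1?adj_sym // setUC.
move=> uv Xuv mono.
have vNB : v \notin B by have := B_proper uv; rewrite uB; case: (v \in B).
pose S := [set x | (x \in X) != (x \in B)].
have cross x y : x \in S -> y \notin S -> adj T x y -> [set x; y] = [set u; v].
  move=> xS yS xy; apply: mono => //; move: xS yS (B_proper xy); rewrite !inE.
  by case: (x \in X); case: (x \in B); case: (y \in X); case: (y \in B).
have uvS : (u \in S) != (v \in S).
  by rewrite !inE Xuv uB (negbTE vNB); case: (v \in X).
have SX : #|X| + #|S :&: B| = #|B| + #|S :\: B|.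
  have -> : S :&: B = B :\: X.
    by apply/setP=> x; rewrite !inE; case: (x \in X); case: (x \in B).
  have -> : S :\: B = X :\: B.
    by apply/setP=> x; rewrite !inE; case: (x \in X); case: (x \in B).
  have := cardsID X B; have := cardsID B X; rewrite setIC; lia.
have S0 : S != set0.
  apply/set0Pn; have [uS|uNS] := boolP (u \in S); first by exists u.
  by exists v; move: uvS; rewrite (negbTE uNS); case: (v \in S).
have := forest_bound acT S0.
have cS := cardsID B S.
pose D := \sum_(x in S :&: B) deg_in T S x.
(* S :&: B and S :\: B span no edges, so D is also the sum over S :\: B. *)
have DA : \sum_(x in S :\: B) deg_in T S x = D.
  have part (A1 A2 : {set V}) : A1 :|: A2 = S -> [disjoint A1 & A2] ->
      {in A1 &, forall x y, (x \in B) = (y \in B)} ->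
      \sum_(x in A1) deg_in T S x = \sum_(x in A1) \sum_(y in A2) adj T x y.
    move=> <- dis same; apply: eq_bigr => x xA1; rewrite /deg_in.
    rewrite (big_setID A1) /= [X in X + _]big1 => [|y]; last first.
      rewrite inE => /andP[_ yA1]; apply/eqP; rewrite eqb0; apply/negP => /B_proper.
      by rewrite (same x y) ?eqxx.
    rewrite add0n; apply: eq_bigl => y; rewrite !inE.
    have [yA1|] //= := boolP (y \in A1).
    by rewrite (disjointFr dis yA1).
  have dis : [disjoint S :&: B & S :\: B].
    rewrite -setI_eq0; apply/eqP/setP=> x; rewrite !inE.
    by case: (x \in B); rewrite ?andbF.
  rewrite /D (part (S :&: B) (S :\: B)) ?setID //; last first.
    by move=> x y; rewrite !inE => /andP[_ ->] /andP[_ ->].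
  rewrite [RHS]exchange_big (part (S :\: B) (S :&: B)) 1?setUC ?setID //; first last.
  - by move=> x y; rewrite !inE => /andP[/negbTE-> _] /andP[/negbTE-> _].
  - by rewrite disjoint_sym.
  by apply: eq_bigr => x _; apply: eq_bigr => y _; rewrite adj_sym.
rewrite (big_setID B) /= -/D DA => DS.
have degS x : x \in S -> deg T x = deg_in T S x + \sum_(y in ~: S) adj T x y.
  move=> xS; rewrite -deg_in_setT /deg_in (big_setID S) /= setTI setTD //.
have degB x : x \in S :&: B -> deg T x <= deg_in T S x + (x == u).
  rewrite inE => /andP[xS xB]; rewrite degS // leq_add2l.
  have end_u y : y \notin S -> adj T x y -> x = u /\ y = v.
    move=> yS xy; have := cross _ _ xS yS xy.
    move=> /setP e; have := e x; rewrite !inE eqxx /= => /esym/orP[/eqP xu|/eqP xv].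
      split=> //; have := e v; rewrite !inE eqxx orbT => /orP[|]/eqP // vx.
      by rewrite vx xB in vNB.
    by rewrite xv (negbTE vNB) in xB.
  have out y : y \in ~: S -> y != v -> adj T x y = false.
    rewrite inE => yS yv; apply: contraNF yv => /(end_u _ yS)[_ ->]; exact: eqxx.
  have [xu|xu] := eqVneq x u.
    have [vS|vS] := boolP (v \in ~: S).
      rewrite (bigD1 v) //= big1 ?addn0 ?leq_b1 // => y /andP[yS yv].
      by rewrite out.
    rewrite big1 // => y yS; rewrite out //.
    by apply: contraNneq vS => <-.
  rewrite big1 // => y; rewrite inE => yS; apply/eqP; rewrite eqb0.
  by apply: contraNN xu => /(end_u _ yS)[-> _].
have sumu (A : {set V}) : \sum_(x in A) (x == u) = (u \in A).
  have [uA|uA] := boolP (u \in A).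
    by rewrite (bigD1 u) //= eqxx big1 // => x /andP[_ /negbTE->].
  rewrite big1 // => x xA; apply/eqP; rewrite eqb0.
  by apply: contraNneq uA => <-.
have Ddeg : \sum_(x in S :&: B) deg T x <= D + (u \in S :&: B).
  by rewrite -sumu -big_split leq_sum.
rewrite ltnNge; apply/negP => XB.
have deg2 : 2 * #|S :&: B| <= \sum_(x in S :&: B) deg T x.
  rewrite mulnC -sum_nat_const; apply: leq_sum => x.
  by rewrite inE => /andP[_ /B_deg].
have uS : u \in S :&: B by case: (u \in _) Ddeg; lia.
have vS : v \notin S.
  by move: uS uvS; rewrite inE => /andP[-> _]; case: (v \in S).
have [/exists_inP[b bS b3]|] := boolP [exists b in S :&: B, 2 < deg T b].
  suff : 2 * #|S :&: B| < \sum_(x in S :&: B) deg T x.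
    move: Ddeg; rewrite uS; lia.
  rewrite (cardsD1 b) bS (big_setD1 b bS) /=.
  suff : 2 * #|(S :&: B) :\ b| <= \sum_(x in (S :&: B) :\ b) deg T x by lia.
  rewrite mulnC -sum_nat_const; apply: leq_sum => x.
  by rewrite !inE => /and3P[_ _ /B_deg].
rewrite negb_exists_in => /forall_inP no3.
suff : 2 * #|S :\: B| <= D by move: Ddeg; rewrite uS; lia.
rewrite -DA mulnC -sum_nat_const; apply: leq_sum => x xSB.
have [xB xS] : x \notin B /\ x \in S by move: xSB; rewrite inE => /andP[].
have inS y : adj T x y -> y \in S.
  move=> xy; apply: contraT => yS; have := cross _ _ xS yS xy.
  move=> /setP e; have := e x; rewrite !inE eqxx /= => /esym/orP[/eqP xu|/eqP xv].
    by rewrite xu uB in xB.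
  by rewrite -xv xS in vS.
have <- : deg T x = deg_in T S x.
  rewrite degS // big1 ?addn0 // => y; rewrite inE => yS; apply/eqP.
  by rewrite eqb0; apply: contraNN yS => /inS.
rewrite ltn_neqAle deg_pos andbT eq_sym; apply/negP => xleaf.
have /card_gt0P[y] := deg_pos x; rewrite inE => xy.
have yB : y \in B by have := B_proper xy; rewrite (negbTE xB); case: (y \in B).
by have := no3 y; rewrite inE yB inS //= (leaf_nb _ xy) /leaf // => /(_ isT).
Qed.
(** The complete bipartite graph with parts [P] and its complement is closed
    under adding edges that complete a copy of [T]: an edge violating the cut
    would be the only monochromatic edge of the copy, which is then coloured
    by membership in [P] with at most [#|B|] vertices inside [P]. *)
Lemma cut_closed (W : finType) (P : {set W}) (E : {set {set W}}) (e : {set W}) :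
    #|P| <= #|B| -> (forall a, a \in E -> #|a :&: P| = 1) ->
  copy_through T (e |: E) e -> #|e :&: P| = 1.
Proof.
move=> PB EP /existsP[f /and3P[/injectiveP fi /forall_inP fE /exists_inP[a aT /eqP fa]]].
have [u [v auv]] := edge_ends aT; rewrite {}auv in aT fa.
apply/eqP; apply: contraT => eP.
have cut x y : adj T x y ->
    #|f @: [set x; y] :&: P| = (x \in f @^-1: P) + (y \in f @^-1: P).
  move=> xy; rewrite imsetU1 imset_set1 card_pairI ?inE //.
  by apply: contraTneq xy => /fi ->; rewrite adj_irr.
have : #|B| < #|f @^-1: P|.
  apply: (one_monochromatic_edge (u := u) (v := v)) => //.
    by move: eP; rewrite -fa cut //; case: (u \in _); case: (v \in _).
  move=> x y xy same; apply: (imset_inj fi); rewrite fa.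
  have := fE _ xy; rewrite !inE => /orP[/eqP//|/EP].
  by rewrite cut // same; case: (y \in _).
rewrite -(card_imset (mem (f @^-1: P)) fi) ltnNge => /negP[]; apply: leq_trans PB.
by apply: subset_leq_card; apply/subsetP => y /imsetP[x]; rewrite inE => xP ->.
Qed.

End Recoloring.

(** * The saturation process *)

Lemma injection_into (U W : finType) (M : {set W}) :
  #|U| <= #|M| -> exists2 f : U -> W, injective f & forall x, f x \in M.
Proof.
move=> UM; exists (fun x => enum_val (widen_ord UM (enum_rank x))).
  by move=> x y /enum_val_inj/(congr1 val)/= /val_inj/enum_rank_inj.
by move=> x; apply: enum_valP.
Qed.

Section Process.
Variables (U : finType) (F : sgraph U) (W : finType).
Implicit Types (E D : {set {set W}}) (e : {set W}).

Lemma copy_through_mono E E' e :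
  E \subset E' -> copy_through F E e -> copy_through F E' e.
Proof.
move=> /subsetP sub /existsP[f /and3P[fi /forall_inP fE fe]].
apply/existsP; exists f; rewrite fi fe andbT /=.
by apply/forall_inP => a /fE/sub.
Qed.

Lemma copy_throughI (f : U -> W) E x y : injective f ->
    (forall x y, adj F x y -> [set f x; f y] \in E) -> adj F x y ->
  copy_through F E [set f x; f y].
Proof.
move=> fi fE xy; apply/existsP; exists (finfun f).
have im x' y' : finfun f @: [set x'; y'] = [set f x'; f y'].
  by rewrite imsetU1 imset_set1 !ffunE.
apply/and3P; split.
- by apply/injectiveP => a b; rewrite !ffunE => /fi.
- apply/forall_inP => a aF; have [p [q pq]] := edge_ends aF.
  by rewrite pq im fE // /adj -pq.
- by apply/exists_inP; exists [set x; y] => //; rewrite im.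
Qed.

Lemma copy_through_card E e : copy_through F E e -> #|edges F| <= #|E|.
Proof.
case/existsP=> f /and3P[/injectiveP fi /forall_inP fE _].
rewrite -(card_imset (mem (edges F)) (imset_inj fi)); apply: subset_leq_card.
by apply/subsetP => _ /imsetP[a /fE ? ->].
Qed.

Lemma card_edges_embed : #|U| <= #|W| -> #|edges F| <= #|all_edges W|.
Proof.
rewrite -[#|W|]cardsT => UW; have [f fi _] := injection_into UW.
rewrite -(card_imset (mem (edges F)) (imset_inj fi)); apply: subset_leq_card.
apply/subsetP => _ /imsetP[a /(forall_inP (edgesP F)) a2 ->].
by rewrite inE card_imset.
Qed.

(** The saturation process run in several stages, recording only the sets of
    edges present before and after. *)
Definition reach E E' : Prop := exists s : seq {set W},
  [/\ uniq s, E' = E :|: [set e in s], [disjoint E & [set e in s]] & saturating F E s].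

Lemma saturating_cat E s t :
  saturating F E (s ++ t) =
    saturating F E s && saturating F (E :|: [set e in s]) t.
Proof.
elim: s E => [|e s IHs] E /=.
  by congr saturating; apply/setP=> x; rewrite !inE orbF.
rewrite IHs -andbA; congr [&& _, _ & saturating _ _ _].
by apply/setP=> x; rewrite !inE; case: (x == e); rewrite ?orbT.
Qed.

Lemma reach_trans E1 E2 E3 : reach E1 E2 -> reach E2 E3 -> reach E1 E3.
Proof.
case=> s [Us -> ds sats] [t [Ut -> dt satt]]; exists (s ++ t).
have st : [set e in s ++ t] = [set e in s] :|: [set e in t].
  by apply/setP=> x; rewrite !inE mem_cat.
move: dt; rewrite -setI_eq0 setIUl setU_eq0 !setI_eq0 => /andP[dt1 dt2].
split.
- rewrite cat_uniq Us Ut andbT /=; apply/hasPn => x xt; apply/negP => xs.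
  by have := disjointFr dt2 (x := x); rewrite !inE xs xt => /(_ isT).
- by rewrite st setUA.
- by rewrite st -setI_eq0 setIUr setU_eq0 !setI_eq0 ds dt1.
- by rewrite saturating_cat sats.
Qed.

(** Edges that can each be added at once can be added together, in any order,
    because a larger graph contains every copy that a smaller one does. *)
Lemma reach_add E D :
  (forall e, e \in D -> copy_through F (e |: E) e) -> reach E (E :|: D).
Proof.
move=> DE; exists (enum (D :\: E)).
have en : [set e in enum (D :\: E)] = D :\: E.
  by apply/setP=> x; rewrite inE mem_enum.
rewrite en; split.
- exact: enum_uniq.
- by apply/setP=> x; rewrite !inE; case: (x \in E).
- by rewrite -setI_eq0; apply/eqP/setP=> x; rewrite !inE; case: (x \in E).
suff sat (s : seq {set W}) E' :
    E \subset E' -> {subset s <= D} -> saturating F E' s.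
  by apply: sat => // e; rewrite mem_enum inE => /andP[].
elim: s E' => //= e s IHs E' EE' sD; apply/andP; split.
  by apply: copy_through_mono (DE e (sD e (mem_head _ _))); apply: setUS.
apply: IHs; first exact: subset_trans EE' (subsetUr _ _).
by move=> x xs; rewrite sD // inE xs orbT.
Qed.

Lemma copy_through_pair E e : copy_through F E e -> e \in all_edges W.
Proof.
case/existsP=> f /and3P[/injectiveP fi _ /exists_inP[a aF /eqP <-]].
by rewrite inE card_imset //; apply: (forall_inP (edgesP F)).
Qed.

Lemma saturating_pairs E s : saturating F E s -> {subset s <= all_edges W}.
Proof.
elim: s E => //= e s IHs E /andP[/copy_through_pair eW /IHs sW] x.
by rewrite inE => /predU1P[->|/sW].
Qed.

Lemma reach_weakly_saturated (G : sgraph W) E :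
  reach (edges G) E -> all_edges W \subset E -> weakly_saturated F G.
Proof.
move=> [s [Us -> dis sats]] /subsetP sub; apply/hasP; exists s => //.
rewrite mem_permutations; apply: uniq_perm; rewrite ?enum_uniq // => x.
rewrite mem_enum inE; apply/idP/andP => [xs|[xG xW]].
  rewrite (saturating_pairs sats) //; split=> //.
  by rewrite (disjointFl dis) // inE.
by have := sub x xW; rewrite !inE (negbTE xG).
Qed.

Lemma saturating_invariant (Q : pred {set W}) E s :
    (forall E' e, (forall a, a \in E' -> Q a) -> copy_through F (e |: E') e -> Q e) ->
    (forall a, a \in E -> Q a) -> saturating F E s ->
  forall a, a \in s -> Q a.
Proof.
move=> step; elim: s E => //= e s IHs E EQ /andP[ce sats] a.
have Qe := step _ _ EQ ce; rewrite inE => /predU1P[->//|].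
by apply: (IHs (e |: E)) => // b; rewrite !inE => /predU1P[->|/EQ].
Qed.

(** The first edge to be added completes a copy of [F], all of whose other
    edges were present; the complete graph contains a copy of [F] anyway. *)
Lemma weakly_saturated_edges (G : sgraph W) :
  #|U| <= #|W| -> weakly_saturated F G -> #|edges F| - 1 <= #|edges G|.
Proof.
move=> UW /hasP[[|e s]]; rewrite mem_permutations.
  move=> /perm_size/=/esym/eqP; rewrite -cardE cards_eq0 setD_eq0.
  move=> /subset_leq_card allG _; rewrite leq_subLR.
  apply: leq_trans (card_edges_embed UW) _.
  exact: leq_trans allG (leq_addl _ _).
move=> _ /andP[/copy_through_card]; rewrite cardsU1; case: (e \notin _); lia.
Qed.

End Process.

(** * Trees with a leaf next to a vertex of degree 2 *)

Section Pendant.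
Variables (V : finType) (T : sgraph V) (l w : V).
Hypotheses (leaf_l : leaf T l) (adj_lw : adj T l w) (deg_w : deg T w = 2).

Lemma neq_wl : w != l.
Proof. by apply: contraTneq adj_lw => ->; rewrite adj_irr. Qed.

Lemma leaf_nbr y : adj T l y -> y = w.
Proof.
move=> ly; have /cards1P[x lx] := leaf_l.
have /set1P-> : y \in [set x] by rewrite -lx inE.
by apply/esym/set1P; rewrite -lx inE.
Qed.

Lemma other_nbr : exists z,
  [/\ z != l, adj T w z & forall y, adj T w y -> y = l \/ y = z].
Proof.
have lN : l \in [set y | adj T w y] by rewrite inE adj_sym.
have := deg_w; rewrite /deg (cardsD1 l) lN => -[/eqP/cards1P[z Nz]].
have : z \in [set z] by rewrite inE.
rewrite -Nz !inE => /andP[zl wz]; exists z; split=> // y wy.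
have [->|yl] := eqVneq y l; [by left|right].
by apply/set1P; rewrite -Nz !inE yl.
Qed.

Section Redirect.
Variables (W : finType) (i : V -> W) (v v' : W).

Definition redirect x := if x == w then v else if x == l then v' else i x.

Lemma redirect_inj :
    injective i -> v != v' ->
    (forall x, x != w -> x != l -> i x != v /\ i x != v') ->
  injective redirect.
Proof.
move=> ii vv' out x y; rewrite /redirect.
have [->|xw] := eqVneq x w; have [->|yw] := eqVneq y w => //.
- have [->|yl] := eqVneq y l; first by move/eqP; rewrite (negbTE vv').
  by have [/eqP h _] := out y yw yl => e; case: h.
- have [->|xl] := eqVneq x l; first by move/eqP; rewrite eq_sym (negbTE vv').
  by have [/eqP h _] := out x xw xl => e; case: h.
have [->|xl] := eqVneq x l; have [->|yl] := eqVneq y l => //.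
- by have [_ /eqP h] := out y yw yl => e; case: h.
- by have [_ /eqP h] := out x xw xl => e; case: h.
by move/ii.
Qed.

Variables (z : V) (E : {set {set W}}).
Hypotheses (zl : z != l) (wz : adj T w z).
Hypothesis w_nbr : forall y, adj T w y -> y = l \/ y = z.

(** The tree meets the leaf [l] and its neighbour [w] only in the path
    [z - w - l], so moving that path to [i z - v - v'] moves no other edge.
    Either edge of the moved path may be the new one. *)
Lemma copy_redirect :
    injective i -> v != v' ->
    (forall x, x != w -> x != l -> i x != v /\ i x != v') ->
    (forall x y, x != w -> x != l -> y != w -> y != l -> adj T x y ->
       [set i x; i y] \in E) ->
    [set i z; v] \in E -> [set v; v'] \in E ->
  copy_through T E [set v; v'] /\ copy_through T E [set i z; v].
Proof.
move=> ii vv' out inner zv vv'E.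
have zw : z != w by apply: contraTneq wz => ->; rewrite adj_irr.
have rw : redirect w = v by rewrite /redirect eqxx.
have rl : redirect l = v'.
  by rewrite /redirect eq_sym (negbTE neq_wl) eqxx.
have rz : redirect z = i z by rewrite /redirect (negbTE zw) (negbTE zl).
have from_w y : adj T w y -> [set redirect w; redirect y] \in E.
  by case/w_nbr=> ->; rewrite rw ?rl // rz setUC.
have from_l y : adj T l y -> [set redirect l; redirect y] \in E.
  by move/leaf_nbr=> ->; rewrite rl rw setUC.
have rE x y : adj T x y -> [set redirect x; redirect y] \in E.
  have [->|xw] := eqVneq x w; first exact: from_w.
  have [->|xl] := eqVneq x l; first exact: from_l.
  have [->|yw] := eqVneq y w; first by rewrite adj_sym setUC; apply: from_w.
  have [->|yl] := eqVneq y l; first by rewrite adj_sym setUC; apply: from_l.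
  by move=> xy; rewrite /redirect (negbTE xw) (negbTE xl) (negbTE yw) (negbTE yl) inner.
have ri := redirect_inj ii vv' out.
rewrite -{1}rw -{1}rl -rw -rz; split; apply: copy_throughI => //.
  by rewrite adj_sym.
by rewrite adj_sym.
Qed.

End Redirect.

(** Start from a copy [i] of the tree among isolated vertices, with the edge
    [i w - i l] missing, and let [L] be the set of vertices outside the copy of
    the tree without its leaf [l]. Redirecting the pendant path adds in turn
    the edges from [i w] to [L] (a new leaf), those from [i z] to [L] (with
    [i w] as the leaf), and those inside [L]. Now [L] is a clique with room for
    the rest of the tree; with this rest inside [L], the edges from [L] to all
    vertices can be added (new leaf outside [L]), and then every other edge,
    as the image of [w l]. *)
Lemma pendant_weakly_saturated (W : finType) : 2 * #|V| + 2 <= #|W| ->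
  exists2 G : sgraph W, weakly_saturated T G & #|edges G| = #|edges T| - 1.
Proof.
move=> VW; have [z [zl wz w_nbr]] := other_nbr.
have VW' : #|V| <= #|[set: W]| by rewrite cardsT; lia.
have [i ii _] := injection_into VW'.
pose L := ~: (i @: (~: [set l])).
have cL : #|V| + 2 <= #|L|.
  have := cardsC (i @: (~: [set l])); rewrite -/L card_imset //.
  have := cardsC [set l]; rewrite cards1; lia.
have outL x v : x != l -> v \in L -> i x != v.
  move=> xl; rewrite inE; apply: contraNneq => <-.
  by apply: imset_f; rewrite !inE.
have ilL : i l \in L.
  by rewrite inE; apply/imsetP => -[x]; rewrite !inE => /negP xl /ii/esym/eqP.
pose E0 := [set i @: a | a : {set V} in edges T] :\ [set i w; i l].
have im x y : i @: [set x; y] = [set i x; i y] by rewrite imsetU1 imset_set1.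
have E0P : [forall e in E0, #|e| == 2].
  apply/forall_inP => e; rewrite inE => /andP[_ /imsetP[a aT ->]].
  by rewrite card_imset //; apply: (forall_inP (edgesP T)).
exists (SGraph E0P); last first.
  have := cardsD1 [set i w; i l] [set i @: a | a : {set V} in edges T].
  rewrite -/E0 card_imset; last exact: imset_inj.
  rewrite -im imset_f /=; last by rewrite -/(adj T w l) adj_sym.
  by move=> ->; rewrite add1n subn1.
have innerE0 x y : x != w -> x != l -> adj T x y -> [set i x; i y] \in E0.
  move=> xw xl xy; rewrite in_setD1 -!im (inj_eq (imset_inj ii)) imset_f // andbT.
  by apply/negP => /eqP/setP/(_ x); rewrite !inE eqxx (negbTE xw) (negbTE xl).
have zw : z != w by apply: contraTneq wz => ->; rewrite adj_irr.
have iw v : v \in L -> i w != v by move=> vL; apply: outL => //; apply: neq_wl.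
(* The bound on L leaves room for all of V even after removing u and u'. *)
have avoid (u u' : W) : exists j : V -> W,
    [/\ injective j, forall x, j x \in L & forall x, j x != u /\ j x != u'].
  have [|j jj jL] := @injection_into V W (L :\ u :\ u').
    have := cardsD1 u L; have := cardsD1 u' (L :\ u); lia.
  exists j; split=> // x; have := jL x; rewrite !inE; by case/and3P.
pose E1 := E0 :|: [set [set i w; v] | v in L].
pose E2 := E1 :|: [set [set i z; v] | v in L].
pose E3 := E2 :|: [set [set p.1; p.2] | p in setX L L & p.1 != p.2].
pose E4 := E3 :|: [set [set p.1; p.2] | p in setX L setT & p.1 != p.2].
have E3P v v' : v \in L -> v' \in L -> v != v' -> [set v; v'] \in E3.
  move=> vL v'L vv'; apply/setUP; right; apply/imsetP.
  by exists (v, v') => //; rewrite !inE /= in vL v'L *; apply/andP; split=> //; apply/andP.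
have E4P v v' : v \in L -> v != v' -> [set v; v'] \in E4.
  move=> vL vv'; apply/setUP; right; apply/imsetP.
  by exists (v, v') => //; rewrite !inE /= in vL *; apply/andP; split=> //; apply/andP.
apply: (reach_weakly_saturated (E := E4 :|: all_edges W)); last exact: subsetUr.
rewrite [edges _]/=.
have step1 : reach T E0 E1.
  apply: reach_add => _ /imsetP[v vL ->].
  apply: (proj1 (@copy_redirect W i (i w) v z _ zl wz w_nbr ii _ _ _ _ _)).
  - exact: iw.
  - by move=> x xw xl; rewrite (inj_eq ii) outL.
  - by move=> x y xw xl _ _ xy; rewrite setU1r ?innerE0.
  - by rewrite setU1r // innerE0 // adj_sym.
  exact: setU11.
have step2 : reach T E1 E2.
  apply: reach_add => _ /imsetP[v vL ->].
  apply: (proj2 (@copy_redirect W i v (i w) z _ zl wz w_nbr ii _ _ _ _ _)).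
  - by rewrite eq_sym iw.
  - by move=> x xw xl; rewrite (inj_eq ii) outL.
  - by move=> x y xw xl _ _ xy; apply/setU1r/setUP; left; apply: innerE0.
  - exact: setU11.
  by rewrite setUC; apply/setU1r/setUP; right; apply: imset_f.
have step3 : reach T E2 E3.
  apply: reach_add => e /imsetP[[v v']] /=; rewrite inE /= inE.
  move=> /andP[/andP[vL v'L] vv'] ->.
  apply: (proj1 (@copy_redirect W i v v' z _ zl wz w_nbr ii _ _ _ _ _)) => //.
  - by move=> x xw xl; rewrite !outL.
  - move=> x y xw xl _ _ xy; apply/setU1r/setUP; left; apply/setUP; left.
    exact: innerE0.
  - by apply/setU1r/setUP; right; apply: imset_f.
  exact: setU11.
have step4 : reach T E3 E4.
  apply: reach_add => e /imsetP[[v u]] /=; rewrite inE /= inE.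
  move=> /andP[/andP[vL _] vu] ->; have [j [jj jL jvu]] := avoid v u.
  apply: (proj1 (@copy_redirect W j v u z _ zl wz w_nbr jj _ _ _ _ _)) => //.
  - move=> x y _ _ _ _ xy; apply/setU1r/E3P => //; rewrite (inj_eq jj).
    by apply: contraTneq xy => ->; rewrite adj_irr.
  - by apply/setU1r/E3P => //; case: (jvu z).
  exact: setU11.
have step5 : reach T E4 (E4 :|: all_edges W).
  apply: reach_add => e; rewrite inE => /cards2P[u [u' [uu' ->]]].
  have [j [jj jL juu']] := avoid u u'.
  apply: (proj1 (@copy_redirect W j u u' z _ zl wz w_nbr jj _ _ _ _ _)) => //.
  - move=> x y _ _ _ _ xy; apply/setU1r/E4P => //; rewrite (inj_eq jj).
    by apply: contraTneq xy => ->; rewrite adj_irr.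
  - by apply/setU1r/E4P => //; case: (juu' z).
  exact: setU11.
apply: reach_trans step1 (reach_trans step2 (reach_trans step3 _)).
exact: reach_trans step4 step5.
Qed.

Lemma pendant_good : good T.
Proof.
exists (2 * #|V| + 2) => n nV.
have VW : 2 * #|V| + 2 <= #|'I_n| by rewrite card_ord.
have [G0 wsG0 cG0] := pendant_weakly_saturated VW.
rewrite /wsat; case: arg_minnP => [|G wsG minG].
  exact: complete_weakly_saturated.
apply/eqP; rewrite eqn_leq -{1}cG0 minG //= weakly_saturated_edges //.
by rewrite card_ord; lia.
Qed.
End Pendant.

(** * Trees with no leaf next to a vertex of degree 2 *)

(** A weakly saturated graph with one edge less than [T] becomes a copy of [T]
    with its first added edge, hence has all its edges across the cut given by
    the image of the colour class [B] without leaves. The later edges then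
    respect this cut too, but with two vertices outside the image of [B] some
    edge of the complete graph does not. *)
Lemma even_leaves_not_good (V : finType) (T : sgraph V) :
    tree T ->
    (forall x y, leaf T x -> leaf T y -> ~~ odd (dist T x y)) ->
    (forall x y, leaf T x -> adj T x y -> deg T y <> 2) ->
  ~ good T.
Proof.
move=> treeT even_leaves no_pendant [N wsatN].
have [V0 conT acT] := treeT.
(* Two vertices more than V, so that two of them lie outside the image of B. *)
pose n := N + #|V| + 2; have := wsatN n; rewrite /n -addnA leq_addr => /(_ isT).
rewrite addnA -/n /wsat; case: arg_minnP => [|G /hasP[s]].
  exact: complete_weakly_saturated.
rewrite mem_permutations => sE sats _ cG.
have nV : #|V| <= #|'I_n| by rewrite card_ord /n; lia.
case: s sE sats => [sE _|e s sE /andP[ce sats]].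
  have /eqP : #|all_edges 'I_n :\: edges G| = 0 by rewrite cardE -(perm_size sE).
  rewrite cards_eq0 setD_eq0 => /subset_leq_card.
  rewrite cG; have := card_edges_embed T nV; rewrite /all_edges card_draws card_ord.
  have : 0 < 'C(n, 2) by rewrite bin_gt0 /n; lia.
  lia.
have [f /and3P[/injectiveP fi /forall_inP fE /exists_inP[a0 a0T _]]] := existsP ce.
have eT : 0 < #|edges T| by apply/card_gt0P; exists a0.
have V2 : 1 < #|V|.
  by rewrite -(eqP (forall_inP (edgesP T) _ a0T)) max_card.
have [r leaf_r] := tree_has_leaf treeT V2.
pose B := [set x | odd (dist T r x)].
have [c cP] := two_coloring acT.
have B_proper x y : adj T x y -> (x \in B) != (y \in B).
  move=> /cP; rewrite !inE !(odd_dist conT cP).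
  by case: (c r); case: (c x); case: (c y).
have leafNB x : leaf T x -> x \notin B by move=> lx; rewrite inE even_leaves.
have degT x : 0 < deg T x by apply: deg_gt0.
have B_deg x : x \in B -> 1 < deg T x.
  move=> xB; rewrite ltn_neqAle degT andbT; apply: contraTneq xB => dx.
  by rewrite leafNB // /leaf -dx.
have leaf_nb x y : leaf T x -> adj T x y -> 2 < deg T y.
  move=> lx xy; rewrite ltn_neqAle; apply/andP; split.
    by apply/eqP => dy; apply: (no_pendant x y).
  apply: B_deg; have := B_proper _ _ xy.
  by rewrite (negbTE (leafNB x lx)); case: (y \in B).
pose P := f @: B.
have EP a : a \in e |: edges G -> #|a :&: P| == 1.
  have -> : e |: edges G = [set f @: b | b : {set V} in edges T].
    apply/esym/eqP; rewrite eqEcard; apply/andP; split.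
      by apply/subsetP => _ /imsetP[b /fE ? ->].
    rewrite card_imset; last exact: imset_inj.
    rewrite cardsU1 cG addnC -leq_subRL ?leq_subr //.
    by rewrite subKn // leq_b1.
  case/imsetP=> b bT ->; have [x [y bxy]] := edge_ends bT; rewrite {}bxy in bT *.
  rewrite -imsetI; last by move=> ? ? _ _; apply: fi.
  rewrite card_imset // card_pairI.
    by have := B_proper x y bT; case: (x \in B); case: (y \in B).
  by apply: contraTneq bT => ->; rewrite -/(adj T y y) adj_irr.
have sP a : a \in s -> #|a :&: P| == 1.
  apply: (saturating_invariant (Q := fun b => #|b :&: P| == 1) _ EP sats).
  move=> E b EQ cb.
  apply/eqP; apply: (cut_closed acT B_proper B_deg leaf_nb degT _ _ cb).
    by rewrite card_imset.
  by move=> b' /EQ/eqP.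
have : 1 < #|~: P|.
  have PV : #|P| <= #|V| by rewrite card_imset // max_card.
  rewrite -(leq_add2l #|P|) cardsC card_ord /n leq_add //.
  exact: leq_trans PV (leq_addl _ _).
case/card_gt1P=> p [q []]; rewrite !inE => pP qP pq.
suff : #|[set p; q] :&: P| == 1 by rewrite card_pairI // (negbTE pP) (negbTE qP).
have [pqG|pqG] := boolP ([set p; q] \in edges G); first by apply: EP; rewrite setU1r.
have : [set p; q] \in e :: s.
  by rewrite (perm_mem sE) mem_enum !inE pqG cards2 pq.
by rewrite inE => /predU1P[->|/sP //]; apply: EP; apply: setU11.
Qed.

Theorem theorem1p4 (V : finType) (T : sgraph V) :
  tree T ->
  (forall x y : V, leaf T x -> leaf T y -> ~~ odd (dist T x y)) ->
  (good T <-> exists x y : V, [/\ leaf T x, adj T x y & deg T y = 2]).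
Proof.
move=> treeT even_leaves; split=> [goodT|[x [y [lx xy dy]]]]; last first.
  exact: pendant_good lx xy dy.
have [/existsP[x /existsP[y /and3P[lx xy /eqP dy]]]|no] :=
  boolP [exists x, exists y, [&& leaf T x, adj T x y & deg T y == 2]].
  by exists x, y.
case: (even_leaves_not_good treeT even_leaves) => // x y lx xy dy.
case/negP: no; apply/existsP; exists x; apply/existsP; exists y.
by rewrite lx xy dy eqxx.
Qed.
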